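(* Let $n\ge 2$ be an integer, let $\xi_n=\frac{n+1}{n-1}$, let $\rho\in\mathbb{C}\setminus\{-\xi_n,-1,0,1,\xi_n\}$ and let $\lambda$ be an eigenvalue of $K_n(\rho)$. Then the following three statements are equivalent: (i) $\lambda$ is a repeated eigenvalue of $K_n(\rho)$. (ii) $\lambda$ is a double eigenvalue of $K_n(\rho)$. (iii) $\lambda=-n$.
   Context: For an integer $n\ge 2$ and $\rho\in\mathbb{C}$, $K_n(\rho)=[\rho^{|j-k|}]_{j,k=1}^n$. ''Repeated'' means algebraic multiplicity at least $2$, and ''double'' means algebraic multiplicity exactly $2$. *)

(* Defs.v *)
From mathcomp Require Import all_boot all_order all_algebra.
From mathcomp Require Import reals complex.

Set Implicit Arguments.
Unset Strict Implicit.
Unset Printing Implicit Defensive.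

Import Order.TTheory GRing.Theory Num.Theory.
Local Open Scope ring_scope.

(* Indices run over 0, ..., n-1 rather than 1, ..., n; only |j - k| matters.
   The subtraction in the exponent is that of int, hence not truncated. *)
Definition KMS (F : fieldType) (n : nat) (rho : F) : 'M[F]_n :=
  \matrix_(j < n, k < n) rho ^+ `|(j : nat)%:Z - (k : nat)%:Z|%N.

Definition xi (F : fieldType) (n : nat) : F := (n%:R + 1) / (n%:R - 1).

Definition alg_mult (F : fieldType) (n : nat) (A : 'M[F]_n) (x : F) : nat :=
  mup x (char_poly A).

Definition repeated_eigenvalue (F : fieldType) (n : nat) (A : 'M[F]_n) (x : F) :
  bool := eigenvalue A x && (2 <= alg_mult A x)%N.

Definition double_eigenvalue (F : fieldType) (n : nat) (A : 'M[F]_n) (x : F) :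
  bool := eigenvalue A x && (alg_mult A x == 2)%N.

(* Main.v *)
Require Import Defs.
From mathcomp Require Import all_boot all_order all_algebra.
From mathcomp Require Import reals complex.
From mathcomp Require Import ring zify.

Set Implicit Arguments.
Unset Strict Implicit.
Unset Printing Implicit Defensive.

(** Fix [rho] with [rho ^ 2 <> 0, 1], let [c = 1 - rho ^ 2], and let [chi] be the
    characteristic polynomial of the Kac-Murdock-Szego matrix [K] of size [n].

    Subtracting [rho] times its predecessor from each row and each column of
    [X - K] is a determinant-one congruence onto a tridiagonal matrix whose
    diagonal is constant, equal to [P = (1 + rho ^ 2) X - c], except for its
    first entry [X - 1], and whose other nonzero entries are [- rho X].  With
    [Q = (rho X) ^ 2], expanding the determinant expresses [chi] through the
    Lucas sequence [U] of parameters [P] and [Q] (a homogeneous form of the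
    Chebyshev polynomials of the second kind):
      [chi = U_(n+1) - rho ^ 2 (X + 1) U_n]            ([char_poly_KMS]).

    Chebyshev polynomials satisfy a first order differential relation
    ([lucas_deriv]); once transported to [chi], all the terms that are not
    multiples of [chi] combine, up to a constant, into [(X + n) U_n]:
      [(P ^ 2 - 4 Q) X chi' = S chi - 2 c rho ^ 2 (X + n) U_n]
                                                      ([char_poly_KMS_deriv]).

    At a root [x] of [chi] none of the other factors vanishes: [x <> 0] because
    [K] is invertible; [U_n(x) <> 0] by the quadratic invariant of Lucas
    sequences; and if [P ^ 2 - 4 Q] vanished at [x], the relation would give
    [x = - n], where [P ^ 2 - 4 Q] factors as
      [((n-1) rho - (n+1)) ((n-1) rho + (n+1)) (rho - 1) (rho + 1)],
    so that [rho] would be one of the excluded values.  Comparing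
    the orders of vanishing at [x] in the relation, the multiplicity of [x] in
    [chi'], which is one less than in [chi], is that of [x] in [X + n]: it is 1
    if [x = - n] and 0 otherwise ([alg_mult_KMS]).  The equivalences follow. *)

Import Order.TTheory GRing.Theory Num.Theory.
Local Open Scope ring_scope.

(** * Determinants of tridiagonal matrices *)

(** Entries of banded matrices are sums of terms guarded by equalities between
    indices; this decides these guards by linear arithmetic and drops the terms
    that vanish. *)
Ltac decide_eqn := repeat match goal with |- context [?x == ?y] =>
  first [have -> : (x == y) = false by lia | have -> : (x == y) = true by lia]
  end; rewrite ?(mulr0n, mulr1n, oppr0, addr0, add0r).

Definition tridiag (R : comNzRingType) (a b c : nat -> R) n : 'M[R]_n :=
  \matrix_(i < n, j < n)
    (a i *+ (i == j) + b i *+ (j == i.+1 :> nat) + c j *+ (i == j.+1 :> nat)).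

(** The three-term recurrence of continuants: expand along the last row, then
    along the last column of the minor that is not tridiagonal. *)
Lemma det_tridiag_rec (R : comNzRingType) (a b c : nat -> R) n :
  \det (tridiag a b c n.+2) =
  a n.+1 * \det (tridiag a b c n.+1) - b n * c n * \det (tridiag a b c n).
Proof.
(* The last row has only two nonzero entries, in columns [i0] and [ord_max]. *)
pose i0 : 'I_n.+2 := widen_ord (leqnSn n.+1) ord_max.
rewrite (expand_det_row _ ord_max) !big_ord_recr /= big1 ?add0r; last first.
  move=> k _; rewrite !mxE /=.
  rewrite -val_eqE /=; have ltk := ltn_ord k.
  by decide_eqn; rewrite mul0r.
have -> : tridiag a b c n.+2 ord_max i0 = c n.
  rewrite !mxE -!val_eqE /= !eqxx.
  by decide_eqn.
have -> : tridiag a b c n.+2 ord_max ord_max = a n.+1.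
  rewrite !mxE -!val_eqE /= !eqxx.
  by decide_eqn.
have bumpn k : (k < n)%N -> bump n k = k.
  by move=> ltk; rewrite /bump leqNgt ltk.
have bumpSn k : (k < n.+1)%N -> bump n.+1 k = k.
  by move=> ltk; rewrite /bump leqNgt ltk.
have sgn_even k : (-1) ^+ (k + k) = 1 :> R.
  by rewrite addnn -signr_odd odd_double.
rewrite /cofactor /= addSn exprS !sgn_even mulr1 mul1r.
have -> : row' ord_max (col' ord_max (tridiag a b c n.+2)) = tridiag a b c n.+1.
  by apply/matrixP => i j; rewrite !mxE -!val_eqE /= !bumpSn.
suff -> : \det (row' ord_max (col' i0 (tridiag a b c n.+2)))
          = b n * \det (tridiag a b c n) by ring.
rewrite (expand_det_col _ ord_max) big_ord_recr /= big1 ?add0r; last first.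
  move=> k _; have ltk := ltn_ord k.
  rewrite !mxE -!val_eqE /= bumpSn ?ltnS 1?ltnW // /bump leqnn add1n.
  by decide_eqn; rewrite mul0r.
rewrite /cofactor /= sgn_even mul1r.
congr (_ * _).
  rewrite !mxE -!val_eqE /= bumpSn // /bump leqnn add1n /= eqxx.
  by decide_eqn.
congr (\det _); apply/matrixP => i j; rewrite !mxE -!val_eqE /= !bumpn //.
by rewrite bumpSn // ltnS ltnW.
Qed.

(** * Reduction of the characteristic matrix to tridiagonal form *)

(** Left multiplication by this matrix subtracts from each row [r] times the
    preceding one; the powers of [r] in a Kac-Murdock-Szego matrix are designed
    to cancel under this operation. *)
Definition elim_mx (R : comNzRingType) (r : R) n : 'M[R]_n :=
  \matrix_(i < n, j < n) ((i == j)%:R - r *+ (i == j.+1 :> nat)).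

Lemma det_elim_mx (R : comNzRingType) (r : R) n : \det (elim_mx r n) = 1.
Proof.
rewrite det_trig; last first.
  apply/is_trig_mxP => i j ltij; rewrite !mxE -val_eqE /=.
  by decide_eqn.
rewrite big1 // => i _; rewrite !mxE eqxx.
by decide_eqn.
Qed.

Lemma elim_mx_sum (R : comNzRingType) (r : R) n (i : 'I_n) (f : nat -> R) :
  \sum_(k < n) elim_mx r n i k * f k =
  f i - (if val i is i'.+1 then r * f i' else 0).
Proof.
rewrite (bigD1 i) //= {1}mxE eqxx.
case: i => [[|i] ltin] /=.
  rewrite !subr0 mul1r big1 ?addr0 // => j /negbTE nij.
  by rewrite !mxE eq_sym nij sub0r mulr0n oppr0 mul0r.
have lti'n : (i < n)%N by lia.
rewrite (bigD1 (Ordinal lti'n)) /=; last by rewrite -val_eqE /=; lia.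
rewrite !mxE -!val_eqE /= eqxx big1 ?addr0.
  by decide_eqn; rewrite mul1r mulNr.
move=> j; rewrite !mxE -!val_eqE /= => /andP[n1 n2].
by decide_eqn; rewrite mul0r.
Qed.

(** The trace-like parameter [P] and, below, the norm-like parameter [Q] of the
    Lucas sequence attached to [K]: the generic diagonal entry of the reduced
    characteristic matrix, and the product of its two off-diagonal entries. *)
Definition kms_P (F : fieldType) (rho : F) : {poly F} :=
  'X * (1 + rho ^+ 2)%:P - (1 - rho ^+ 2)%:P.

Definition kms_Q (F : fieldType) (rho : F) : {poly F} := (rho%:P * 'X) ^+ 2.

(** The congruence by [elim_mx] kills every entry off the three central
    diagonals, since the entries of [K] on a row or a column are, away from the
    diagonal, in geometric progression of ratio [rho]. *)
Lemma elim_char_KMS (F : fieldType) (rho : F) n :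
  elim_mx rho%:P n *m char_poly_mx (KMS n rho) *m (elim_mx rho%:P n)^T =
  tridiag (fun i => if i == 0%N then 'X - 1 else kms_P rho)
          (fun=> - (rho%:P * 'X)) (fun=> - (rho%:P * 'X)) n.
Proof.
(* The entries, extended to all natural indices so that neighbours of a
   boundary entry need no bound. *)
pose b (i j : nat) : {poly F} :=
  'X *+ (i == j) - rho%:P ^+ `|(i : nat)%:Z - (j : nat)%:Z|%N.
have Eb i j : char_poly_mx (KMS n rho) i j = b i j.
  by rewrite !mxE rmorphXn.
apply/matrixP => i j.
rewrite mxE.
under eq_bigr => k _.
  rewrite mxE; under eq_bigr => l _ do rewrite Eb.
  rewrite (elim_mx_sum _ i (b^~ k)) mulrC [_^T _ _]mxE.
  over.
rewrite /= (elim_mx_sum _ j (fun k => b i k -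
  match val i with 0 => 0 | i'.+1 => rho%:P * b i' k end)).
rewrite !mxE -val_eqE /= {Eb}.
move: (nat_of_ord i) (nat_of_ord j) => {}i {}j.
(* [b] depends only on the distance to the diagonal.  Its values at small
   offsets are listed in the shapes in which they occur below, where [k] is the
   distance of the entry under study to the nearest off-diagonal. *)
have bS x y : b x.+1 y.+1 = b x y by rewrite /b eqSS; congr (_ - _ ^+ _); lia.
have bd x : b x x = 'X - 1 by rewrite /b eqxx subrr.
have bu k x : b x (x + k).+1 = - rho%:P ^+ k.+1.
  by rewrite /b; decide_eqn; congr (- _ ^+ _); lia.
have bl k x : b (x + k).+1 x = - rho%:P ^+ k.+1.
  by rewrite /b; decide_eqn; congr (- _ ^+ _); lia.
have bu0 x : b x x.+1 = - rho%:P by have := bu 0%N x; rewrite addn0 expr1.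
have bl0 x : b x.+1 x = - rho%:P by have := bl 0%N x; rewrite addn0 expr1.
have bu2 k x : b x (x + k).+2 = - rho%:P ^+ k.+2 by rewrite -addnS bu.
have bl2 k x : b (x + k).+2 x = - rho%:P ^+ k.+2 by rewrite -addnS bl.
have bu3 k x : b x (x + k).+3 = - rho%:P ^+ k.+3 by rewrite -addnS bu2.
have bl3 k x : b (x + k).+3 x = - rho%:P ^+ k.+3 by rewrite -addnS bl2.
have bu1 x : b x x.+2 = - rho%:P ^+ 2 by have := bu2 0%N x; rewrite addn0.
have bl1 x : b x.+2 x = - rho%:P ^+ 2 by have := bl2 0%N x; rewrite addn0.
rewrite /kms_P !(rmorphB, rmorphD, rmorphXn, rmorph1) /=.
have [lt|lt|<-] := ltngtP i j.
- have [[|k] ->] : exists k, j = (i + k).+1 by exists (j - i.+1)%N; lia.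
    rewrite addn0; case: i {lt} => [|i]; decide_eqn; rewrite ?bS ?bd ?bu0 ?bu1; ring.
  case: i {lt} => [|i]; decide_eqn;
    rewrite ?addSn ?addnS ?bS ?bu3 ?bu2 ?bu !exprS; ring.
- have [[|k] ->] : exists k, i = (j + k).+1 by exists (i - j.+1)%N; lia.
    rewrite addn0; case: j {lt} => [|j]; decide_eqn; rewrite ?bS ?bd ?bl0 ?bl1; ring.
  case: j {lt} => [|j]; decide_eqn;
    rewrite ?addSn ?addnS ?bS ?bl3 ?bl2 ?bl !exprS; ring.
- case: i => [|i]; decide_eqn; rewrite ?bS ?bd ?bu0 ?bl0; ring.
Qed.

(** * Lucas sequences *)

(** The Lucas sequence of the first kind: up to homogenization, [lucas P Q n]
    is the Chebyshev polynomial of the second kind of degree [n - 1]. *)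
Fixpoint lucas (R : comNzRingType) (P Q : R) (n : nat) : R :=
  match n with
  | 0 => 0
  | 1 => 1
  | (m.+1 as m').+1 => P * lucas P Q m' - Q * lucas P Q m
  end.

Lemma lucasSS (R : comNzRingType) (P Q : R) n :
  lucas P Q n.+2 = P * lucas P Q n.+1 - Q * lucas P Q n.
Proof. by []. Qed.

(** The quadratic form [u ^ 2 - P u v + Q v ^ 2] is multiplied by [Q] at each
    step; it is the homogeneous form of the identity between squares of sine and
    cosine, and shows that consecutive terms have no common zero when [Q] is
    invertible. *)
Lemma lucas_quadratic (R : comNzRingType) (P Q : R) n :
  lucas P Q n.+1 ^+ 2 - P * lucas P Q n.+1 * lucas P Q n
    + Q * lucas P Q n ^+ 2 = Q ^+ n.
Proof.
elim: n => [|n IHn]; first by rewrite /=; ring.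
by rewrite lucasSS [Q ^+ n.+1]exprS -IHn; ring.
Qed.

(** The first order differential relation of Chebyshev polynomials.  The
    hypotheses say how the Euler operator [X d/dX] acts on [P] and [Q]: it
    doubles [Q], and would fix [P] but for the defect [c].  Since
    [lucas P Q n] is homogeneous of weight [n - 1] when [P] and [Q] have weights
    1 and 2, the left-hand side measures how much this defect propagates. *)
Lemma lucas_deriv (R : comNzRingType) (P Q c : {poly R}) n :
  'X * P^`() - P = c -> 'X * Q^`() = 2%:R * Q ->
  (P ^+ 2 - 4%:R * Q) *
    ('X * (lucas P Q n)^`() - (n%:R - 1) * lucas P Q n) =
  c * (2%:R * n%:R * lucas P Q n.+1 - (n%:R + 1) * P * lucas P Q n).
Proof.
move=> XP XQ; elim/ltn_ind: n => -[|[|n]] IHn.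
- by rewrite /= deriv0; ring.
- by rewrite /= derivC; ring.
have := IHn n.+1 (leqnn _); have := IHn n (leqnSn _).
rewrite !lucasSS derivB !derivM.
set u := lucas _ _ n; set v := lucas _ _ n.+1.
rewrite -[n.+2%:R]natr1 -[n.+1%:R]natr1 => Iu Iv.
transitivity ((P ^+ 2 - 4%:R * Q) * (c * v
     + P * ('X * v^`() - (n%:R + 1 - 1) * v) - Q * ('X * u^`() - (n%:R - 1) * u))).
  rewrite -XP.
  transitivity ((P ^+ 2 - 4%:R * Q) * ('X * P^`() * v + 'X * P * v^`()
    - 'X * Q^`() * u - 'X * Q * u^`() - (n%:R + 1) * (P * v - Q * u))); first by ring.
  by rewrite XQ; ring.
have -> x y z : (P ^+ 2 - 4%:R * Q) * (x + P * y - Q * z) =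
  (P ^+ 2 - 4%:R * Q) * x + P * ((P ^+ 2 - 4%:R * Q) * y)
   - Q * ((P ^+ 2 - 4%:R * Q) * z) by ring.
by rewrite Iu Iv; ring.
Qed.

(** * The characteristic polynomial and its differential relation *)

Lemma char_poly_KMS (F : fieldType) (rho : F) n :
  char_poly (KMS n rho) =
  lucas (kms_P rho) (kms_Q rho) n.+1
    - (rho ^+ 2)%:P * ('X + 1) * lucas (kms_P rho) (kms_Q rho) n.
Proof.
have -> : char_poly (KMS n rho) = \det (elim_mx rho%:P n *m
    char_poly_mx (KMS n rho) *m (elim_mx rho%:P n)^T).
  by rewrite !det_mulmx det_tr !det_elim_mx mul1r mulr1.
rewrite elim_char_KMS; elim/ltn_ind: n => -[|[|n]] IHn.
- by rewrite det_mx00 /= mulr0 subr0.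
- rewrite det_mx11 mxE /= mulr1n !addr0 mulr1 /kms_P.
  rewrite !(rmorphB, rmorphD, rmorphXn, rmorph1) /=; ring.
rewrite det_tridiag_rec !IHn //= /kms_Q; ring.
Qed.

(** Substituting [lucas_deriv] for both terms of [char_poly_KMS] and eliminating
    [U_(n+1)] in favour of [chi] leaves [U_n] with a coefficient that is a priori
    of degree 3 in [X]; it turns out to be linear, with root [- n].  This is
    where the special eigenvalue comes from. *)
Lemma char_poly_KMS_deriv (F : fieldType) (rho : F) n
    (P := kms_P rho) (Q := kms_Q rho) (chi := char_poly (KMS n rho)) :
  (P ^+ 2 - 4%:R * Q) * 'X * chi^`() =
  n%:R * (P ^+ 2 - 4%:R * Q + (1 - rho ^+ 2)%:P *
    (P - 2%:R * (rho ^+ 2)%:P * ('X + 1))) * chi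
  - 2%:R * (rho ^+ 2 * (1 - rho ^+ 2))%:P * ('X + n%:R) * lucas P Q n.
Proof.
have XP : 'X * P^`() - P = (1 - rho ^+ 2)%:P.
  rewrite /P /kms_P !derivE; ring.
have XQ : 'X * Q^`() = 2%:R * Q.
  rewrite /Q /kms_Q exprMn !derivE; ring.
have := lucas_deriv n.+1 XP XQ; have := lucas_deriv n XP XQ.
rewrite /chi char_poly_KMS -/P -/Q !derivE lucasSS -[n.+1%:R]natr1.
set u := lucas _ _ n; set v := lucas _ _ n.+1; set D := P ^+ 2 - _ => Iu Iv.
have XDu : D * ('X * u^`()) =
    D * ('X * u^`() - (n%:R - 1) * u) + D * (n%:R - 1) * u by ring.
have XDv : D * ('X * v^`()) =
    D * ('X * v^`() - (n%:R + 1 - 1) * v) + D * n%:R * v by ring.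
rewrite Iu in XDu; rewrite Iv in XDv.
transitivity (D * ('X * v^`()) - (rho ^+ 2)%:P * 'X * D * u
   - (rho ^+ 2)%:P * ('X + 1) * (D * ('X * u^`()))); first by ring.
rewrite XDu XDv {Iu Iv XDu XDv XP XQ}.
rewrite /D /P /Q /kms_P /kms_Q !(rmorphM, rmorphB, rmorphD, rmorphXn, rmorph1) /=.
ring.
Qed.

(** * Nonvanishing at the eigenvalues, and multiplicities *)

(** Characteristic zero keeps the factor produced by differentiating the power
    of [X - x] from vanishing. *)
Lemma mup_deriv (F : numFieldType) (x : F) (p : {poly F}) :
  p != 0 -> root p x -> mup x p = (mup x p^`()).+1.
Proof.
move=> p0 px.
have : (0 < mup x p)%N by rewrite -XsubC_dvd // dvdp_XsubCl.
case Em : (mup x p) => [|m] // _.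
have := mup_geq x m.+1 p0; rewrite Em leqnn => /esym/dvdpP[q Ep].
have qx : ~~ root q x.
  apply/negP; rewrite -dvdp_XsubCl => /dvdpP[r Eq].
  have := mup_leq x m.+1 p0; rewrite Em leqnn Ep Eq -mulrA -exprS.
  by rewrite dvdp_mull.
have -> : p^`() = (q *+ m.+1 + q^`() * ('X - x%:P)) * ('X - x%:P) ^+ m.
  rewrite Ep derivM deriv_exp derivXsubC mul1r /= -[q *+ _]mulr_natr.
  by rewrite -[_ ^+ m *+ _]mulr_natr exprS; ring.
rewrite mupMr ?mup_XsubCX ?eqxx //.
by rewrite rootE !hornerE subrr mulr0 addr0 hornerMn mulrn_eq0.
Qed.

Lemma lucas_horner (R : comNzRingType) (P Q : {poly R}) x n :
  (lucas P Q n).[x] = lucas P.[x] Q.[x] n.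
Proof.
elim/ltn_ind: n => -[|[|n]] IHn; rewrite ?horner0 ?hornerC //.
by rewrite !lucasSS !hornerE !IHn.
Qed.

Lemma lucas0r (R : comNzRingType) (P : R) n : lucas P 0 n.+1 = P ^+ n.
Proof. by elim: n => // n IHn; rewrite lucasSS IHn mul0r subr0 exprS. Qed.

(** At [X = 0] the parameter [Q] vanishes and the Lucas sequence is geometric, so
    the constant term of [chi] is a power of [rho ^ 2 - 1] up to sign. *)
Lemma KMS_eigenvalue_neq0 (F : fieldType) (rho x : F) n :
  rho ^+ 2 != 1 -> root (char_poly (KMS n rho)) x -> x != 0.
Proof.
move=> rho1; case: n => [|n].
  by rewrite char_poly_KMS /= mulr0 subr0 (negbTE (root1 x)).
apply: contraTneq => ->; rewrite rootE char_poly_KMS.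
rewrite hornerD hornerN [(_ * _).[0]]hornerM !lucas_horner.
have -> : ((rho ^+ 2)%:P * ('X + 1)).[0] = rho ^+ 2.
  by rewrite !hornerE; ring.
have -> : (kms_Q rho).[0] = 0 by rewrite /kms_Q !hornerE expr0n.
have -> : (kms_P rho).[0] = rho ^+ 2 - 1.
  by rewrite /kms_P !hornerE; ring.
rewrite !lucas0r [_ ^+ n.+1]exprS -mulrBl mulf_neq0 ?expf_neq0 ?subr_eq0 //.
by rewrite -subr_eq0 addrAC subrr add0r oppr_eq0 oner_eq0.
Qed.

(** If [U_n] vanished at a root of [chi], so would [U_(n+1)], and the quadratic
    invariant [Q ^ n] with them. *)
Lemma KMS_root_lucas_neq0 (F : fieldType) (rho x : F) n :
  rho != 0 -> rho ^+ 2 != 1 -> root (char_poly (KMS n rho)) x ->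
  (lucas (kms_P rho) (kms_Q rho) n).[x] != 0.
Proof.
move=> rho0 rho1 chix; have x0 := KMS_eigenvalue_neq0 rho1 chix.
move: chix; rewrite rootE char_poly_KMS hornerD hornerN hornerM !lucas_horner.
apply: contraTneq => U0; rewrite U0 mulr0 subr0.
have := lucas_quadratic (kms_P rho).[x] (kms_Q rho).[x] n.
rewrite U0 expr0n /= !mulr0 subr0 addr0 => vQ.
by rewrite -sqrf_eq0 vQ expf_neq0 // /kms_Q !hornerE expf_neq0 // mulf_neq0.
Qed.

(** At a root of [P ^ 2 - 4 Q] the differential relation forces [X = - n], and
    there [P ^ 2 - 4 Q] vanishes only if [rho] is 1, -1, [xi] or [- xi].  In
    trigonometric terms the vanishing of the discriminant corresponds to
    [sin theta = 0], the degenerate case of the usual parametrization of the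
    eigenvalues. *)
Lemma KMS_discr_neq0 (F : numFieldType) (rho x : F) n
    (P := kms_P rho) (Q := kms_Q rho) :
  (1 < n)%N -> rho \notin [:: - xi F n; -1; 0; 1; xi F n] ->
  root (char_poly (KMS n rho)) x -> (P ^+ 2 - 4%:R * Q).[x] != 0.
Proof.
move=> n1; rewrite !inE !negb_or => /and5P[rNxi rN1 r0 r1 rxi] chix.
have rr1 : rho ^+ 2 != 1 by rewrite sqrf_eq1 negb_or r1.
have U0 := KMS_root_lucas_neq0 r0 rr1 chix.
apply/negP => /eqP D0.
have := char_poly_KMS_deriv rho n; cbv zeta; rewrite -/P -/Q.
set S := (X in X * char_poly _).
move: S (lucas _ _ n) U0 (P ^+ 2 - _) (D0) => S U U0 D Dx0.
move=> rel; have := congr1 (fun p : {poly F} => p.[x]) rel; rewrite /=.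
rewrite hornerD hornerN !hornerM Dx0 (rootP chix) !mul0r mulr0 sub0r.
move=> /esym/eqP; rewrite -!polyC_natr !hornerE oppr_eq0 !mulf_eq0 pnatr_eq0 /=.
rewrite (negbTE U0) (negbTE r0) subr_eq0 eq_sym (negbTE rr1) !orbF /=.
rewrite addr_eq0 => /eqP Ex.
have n0 : n%:R - 1 != 0 :> F by rewrite subr_eq0 pnatr_eq1; lia.
have xiE : xi F n * (n%:R - 1) = n%:R + 1 by rewrite /xi divfK.
have DE : (P ^+ 2 - 4%:R * Q).[x] =
    (x * (1 + rho ^+ 2) - (1 - rho ^+ 2) - 2%:R * rho * x) *
    (x * (1 + rho ^+ 2) - (1 - rho ^+ 2) + 2%:R * rho * x).
  rewrite /P /Q /kms_P /kms_Q -polyC_natr.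
  by rewrite !(horner_exp, hornerD, hornerN, hornerM, hornerX, hornerC); ring.
have /eqP : (n%:R - 1) ^+ 2 *
    ((rho - 1) * (rho + 1) * (rho - xi F n) * (rho + xi F n)) = 0.
  rewrite -D0 DE Ex.
  transitivity ((rho - 1) * (rho + 1) * ((n%:R - 1) * rho - xi F n * (n%:R - 1))
    * ((n%:R - 1) * rho + xi F n * (n%:R - 1))); first by ring.
  by rewrite xiE; ring.
rewrite !mulf_eq0 (negbTE n0) !(subr_eq0, addr_eq0).
by rewrite (negbTE r1) (negbTE rN1) (negbTE rxi) (negbTE rNxi).
Qed.

(** The order of vanishing at [x] of each term of [char_poly_KMS_deriv] is known:
    for the term in [chi'] it is [mup x chi'], for the multiple of [chi] it is
    larger, hence for the term in [(X + n) U_n], where it is 1 or 0 according to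
    whether [x = - n], it equals [mup x chi']. *)
Lemma alg_mult_KMS (F : numFieldType) (rho x : F) n :
  (1 < n)%N -> rho \notin [:: - xi F n; -1; 0; 1; xi F n] ->
  eigenvalue (KMS n rho) x ->
  alg_mult (KMS n rho) x = (x == - n%:R).+1.
Proof.
move=> n1 rhoP; rewrite eigenvalue_root_char /alg_mult => chix.
have chi0 : char_poly (KMS n rho) != 0 by rewrite monic_neq0 ?char_poly_monic.
have D0 := KMS_discr_neq0 n1 rhoP chix.
move: rhoP; rewrite !inE !negb_or => /and5P[_ rN1 r0 r1 _].
have rr1 : rho ^+ 2 != 1 by rewrite sqrf_eq1 negb_or r1.
have U0 := KMS_root_lucas_neq0 r0 rr1 chix.
have x0 := KMS_eigenvalue_neq0 rr1 chix.
have dchi := char_poly_KMS_deriv rho n; cbv zeta in dchi.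
set chi := char_poly _ in chix chi0 dchi *.
have mchi := mup_deriv chi0 chix; rewrite mchi; congr _.+1.
set D := _ - _ in dchi D0; set U := lucas _ _ _ in dchi U0.
set k := (rho ^+ 2 * _)%:P in dchi.
have mT : mup x (2%:R * k * ('X + n%:R) * U) = (x == - n%:R).
  rewrite mupMl // mupMr; last first.
    by rewrite rootE -polyC_natr !hornerE !mulf_neq0 ?pnatr_eq0 ?expf_neq0 //
      subr_eq0 eq_sym.
  rewrite -polyC_natr -[n%:R%:P]opprK -polyCN -['X - _]expr1 mup_XsubCX eq_sym.
  by case: eqP.
have mE : mup x (D * 'X * chi^`()) = mup x chi^`().
  by rewrite mupMr // rootE hornerM hornerX mulf_neq0.
have dchi0 : chi^`() != 0.
  apply: contraTneq chi0 => /(congr1 (coefp n.-1)) /eqP; rewrite /= coef_deriv coef0.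
  rewrite prednK 1?ltnW // mulrn_eq0 -[n in chi`_n]/(n.+1.-1).
  rewrite -(size_char_poly (KMS n rho)) -/(lead_coef _) lead_coef_eq0.
  by case/orP=> [/eqP n0|->//]; rewrite n0 in n1.
have E0 : D * 'X * chi^`() != 0.
  rewrite !mulf_neq0 ?polyX_eq0 //.
  by apply: contraNneq D0 => ->; rewrite horner0.
have T0 : 2%:R * k * ('X + n%:R) * U != 0.
  rewrite !mulf_neq0 //; first by rewrite -polyC_natr polyC_eq0 pnatr_eq0.
  - by rewrite polyC_eq0 mulf_neq0 ?expf_neq0 // subr_eq0 eq_sym.
  - by rewrite -polyC_natr -size_poly_eq0 size_XaddC.
  by apply: contraNneq U0 => ->; rewrite horner0.
set T := 2%:R * _ * _ * _ in dchi T0 mT; set E := D * _ * _ in dchi mE E0.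
have chi_dvd : ('X - x%:P) ^+ (mup x chi^`()).+1 %| E + T.
  by rewrite dchi subrK dvdp_mull // -mup_geq // mchi.
apply/eqP; rewrite -mT -mE in chi_dvd *; rewrite eqn_leq; apply/andP; split.
  have dvdE : ('X - x%:P) ^+ mup x E %| E by rewrite -mup_geq.
  rewrite mup_geq // -(dvdp_addr _ dvdE).
  exact: dvdp_trans (dvdp_exp2l _ (leqnSn _)) chi_dvd.
rewrite mup_leq //; apply/negP => dvdT.
have : ('X - x%:P) ^+ (mup x E).+1 %| E by rewrite -(dvdp_addl _ dvdT).
by rewrite -mup_geq // ltnn.
Qed.

Theorem theorem3p1 (R : realType) (n : nat) (rho lambda : R[i])
    (hn : (2 <= n)%N)
    (hrho : rho \notin [:: - xi R[i] n; -1; 0; 1; xi R[i] n])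
    (hlambda : eigenvalue (KMS n rho) lambda) :
  (repeated_eigenvalue (KMS n rho) lambda <->
     double_eigenvalue (KMS n rho) lambda) /\
  (double_eigenvalue (KMS n rho) lambda <-> lambda = - n%:R).
Proof.
rewrite /repeated_eigenvalue /double_eigenvalue hlambda /=.
rewrite (alg_mult_KMS hn hrho hlambda).
by case: eqP => [->|neq] /=; split.
Qed.
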